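(* Let $\lambda\in(0,1)\setminus\{1/2\}$. There exists a nonempty open subset $U$ of $\{(a_1,a_2,a_3,a_4)\in\mathbf{R}^4: 0<a_1<a_2<a_3<a_4<1\}$ such that the following holds. For every $(a_1,a_2,a_3,a_4)\in U$, consider the initial sequence defined by $u_j^0=0$ for $j\le 0$, $u_j^0=a_j$ for $1\le j\le 4$, and $u_j^0=1$ for $j\ge5$, and let $(u^n)_{n\ge0}$ be the solution of the alternately shifted grid process with parameter $\lambda$ and this initial data. Then there exist a sequence $(u_j^\infty)_{j\in\mathbf{Z}}$ and constants $C>0$, $\rho\in(0,1)$ such that $\sup_{j\in\mathbf{Z}}|u_j^{2n}-u_j^\infty|\le C\rho^n$ for all $n\ge0$.
   Context: Alternately shifted grid process with parameter $\lambda\in(0,1)$. For $a\in\mathbf{R}$ let $\mathcal{C}_a=(a-1/2,a+1/2)$. The data at even times is a sequence $(u_j^{2n})_{j\in\mathbf{Z}}$, where $u_j^{2n}$ is attached to the cell $\mathcal{C}_j$; at odd times it is a sequence $(u_{j-\lambda}^{2n+1})_{j\in\mathbf{Z}}$, where $u_{j-\lambda}^{2n+1}$ is attached to $\mathcal{C}_{j-\lambda}$. From time $2n$ to $2n+1$ (grid shifted to the left): let $d_j^{2n}=\frac{u_j^{2n}-u_{j-1}^{2n}}{u_{j+1}^{2n}-u_{j-1}^{2n}}$ ($d_j^{2n}=-1$ if undefined). If $0<d_j^{2n}<1$, the reconstruction $u_{rec}^{2n}$ on $\mathcal{C}_j$ equals $u_{j-1}^{2n}$ where $d_j^{2n}<(j+1/2)-x<1$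 and $u_{j+1}^{2n}$ where $0<(j+1/2)-x<d_j^{2n}$; otherwise $u_{rec}^{2n}=u_j^{2n}$ on $\mathcal{C}_j$. Then $u_{j-\lambda}^{2n+1}=\int_{\mathcal{C}_{j-\lambda}}u_{rec}^{2n}(x)\,dx$. From time $2n+1$ to $2n+2$ (grid shifted to the right): let $d_{j-\lambda}^{2n+1}=\frac{u_{j+1-\lambda}^{2n+1}-u_{j-\lambda}^{2n+1}}{u_{j+1-\lambda}^{2n+1}-u_{j-1-\lambda}^{2n+1}}$ ($-1$ if undefined). If $0<d_{j-\lambda}^{2n+1}<1$, the reconstruction $u_{rec}^{2n+1}$ on $\mathcal{C}_{j-\lambda}$ equals $u_{j-1-\lambda}^{2n+1}$ where $0<x-(j-\lambda-1/2)<d_{j-\lambda}^{2n+1}$ and $u_{j+1-\lambda}^{2n+1}$ where $d_{j-\lambda}^{2n+1}<x-(j-\lambda-1/2)<1$; otherwise $u_{rec}^{2n+1}=u_{j-\lambda}^{2n+1}$ on $\mathcal{C}_{j-\lambda}$. Then $u_j^{2n+2}=\int_{\mathcal{C}_j}u_{rec}^{2n+1}(x)\,dx$. *)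

(* Defs.v *)
From HB Require Import structures.
From mathcomp Require Import all_boot all_order all_algebra.
From mathcomp Require Import all_classical all_reals all_analysis.
Set Implicit Arguments.
Unset Strict Implicit.
Unset Printing Implicit Defensive.
Import Order.TTheory GRing.Theory Num.Theory.
Import numFieldNormedType.Exports.
Local Open Scope classical_set_scope.
Local Open Scope ring_scope.

Definition cell (R : realType) (a : R) : set R :=
  `]a - 2^-1, a + 2^-1[%classic.

(* The value attached to the cell centred at j (even times) or at j - lam (odd
   times) is indexed by the integer j in both cases. *)

Definition d_even (R : realType) (u : int -> R) (j : int) : R :=
  if u (j + 1) - u (j - 1) == 0 then -1
  else (u j - u (j - 1)) / (u (j + 1) - u (j - 1)).

Definition d_odd (R : realType) (u : int -> R) (j : int) : R :=
  if u (j + 1) - u (j - 1) == 0 then -1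
  else (u (j + 1) - u j) / (u (j + 1) - u (j - 1)).

(* Every x in cell j has floor (x + 1/2) = j. The reconstruction is prescribed
   only off the cell endpoints and the jump points; the values chosen there are
   arbitrary and do not affect the integrals. *)
Definition rec_even (R : realType) (u : int -> R) (x : R) : R :=
  let j := Num.floor (x + 2^-1) in
  let d := d_even u j in
  if 0 < d < 1 then
    if d < (j%:~R + 2^-1) - x then u (j - 1) else u (j + 1)
  else u j.

(* Every x in cell (j - lam) has floor (x + lam + 1/2) = j. *)
Definition rec_odd (R : realType) (lam : R) (u : int -> R) (x : R) : R :=
  let j := Num.floor (x + lam + 2^-1) in
  let d := d_odd u j in
  if 0 < d < 1 then
    if x - (j%:~R - lam - 2^-1) < d then u (j - 1) else u (j + 1)
  else u j.

Definition step_even (R : realType) (lam : R) (u : int -> R) (j : int) : R :=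
  \int[lebesgue_measure]_(x in cell (j%:~R - lam)) rec_even u x.

Definition step_odd (R : realType) (lam : R) (u : int -> R) (j : int) : R :=
  \int[lebesgue_measure]_(x in cell (j%:~R : R)) rec_odd lam u x.

Fixpoint alt_process (R : realType) (lam : R) (u0 : int -> R) (n : nat) :
    int -> R :=
  match n with
  | 0%N => u0
  | m.+1 => if odd m then step_odd lam (alt_process lam u0 m)
            else step_even lam (alt_process lam u0 m)
  end.

(* Coordinates of a are numbered from 0, so a_j is a 0 (j - 1). *)
Definition increasing_quadruples (R : realType) : set 'rV[R]_4 :=
  [set a | [/\ 0 < a 0 0, a 0 0 < a 0 1, a 0 1 < a 0 2, a 0 2 < a 0 3
             & a 0 3 < 1]].

Definition initial_data (R : realType) (a : 'rV[R]_4) (j : int) : R :=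
  if j <= 0 then 0
  else if j <= 4 then a 0 (inord `|j - 1|%N)
  else 1.

(* Main.v *)
(* For nondecreasing data the step at even times is the conservative scheme
   u_j |-> F_(j-1) + u_j - F_j with F_j the smaller of lam u_(j+1) and
   u_j - (1 - lam) u_(j-1), and the step at odd times is the same scheme with
   1 - lam in place of lam, up to renumbering the cells. A front with a single
   intermediate value c in [lam, 1] is therefore 2-periodic: its value goes
   c, c - lam, c. If a1 << a2 << 1, a3 is close to (1 + lam)/2 and a4 is close
   to 1, the data become such a front after three steps, so the even times
   converge in finite time, on a whole ball of initial data. *)

Require Import Defs.
From HB Require Import structures.
From mathcomp Require Import all_boot all_order all_algebra.
From mathcomp Require Import all_classical all_reals all_analysis.
From mathcomp Require Import ring lra zify.
Set Implicit Arguments.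
Unset Strict Implicit.
Unset Printing Implicit Defensive.
Import Order.TTheory GRing.Theory Num.Theory.
Import numFieldNormedType.Exports.
Local Open Scope classical_set_scope.
Local Open Scope ring_scope.

(** * Integrals over adjacent open intervals *)

Definition has_integral (R : realType) (f : R -> R) (a b v : R) :=
  measurable_fun `]a, b[ f /\
  (\int[lebesgue_measure]_(x in `]a, b[) (f x)%:E)%E = v%:E.

Lemma has_integral_const (R : realType) (f : R -> R) (k a b : R) :
  a <= b -> {in `]a, b[, forall x, f x = k} ->
  has_integral f a b (k * (b - a)).
Proof.
move=> ab fk; have fk' : {in `]a, b[%classic, cst k =1 f}.
  by move=> x; rewrite inE => xab /=; rewrite fk.
split.
  by apply: (eq_measurable_fun (cst k)) fk' _; exact: measurable_cst.
rewrite (eq_integral (fun=> k%:E)); last by move=> x /fk' /= ->.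
rewrite integral_cst//= lebesgue_measure_itv/= lte_fin.
case: ltP => [_|ba]; first by rewrite EFinM EFinB.
have -> : b = a by lra.
by rewrite subrr mulr0 mule0.
Qed.

(** The two intervals miss [b]; closing the first one at [b] does not change its integral.
    Additivity requires the measurability recorded in [has_integral]. *)
Lemma has_integral_cat (R : realType) (f : R -> R) (a b c v w : R) :
  a <= b -> b <= c -> has_integral f a b v -> has_integral f b c w ->
  has_integral f a c (v + w).
Proof.
move=> ab bc [mv iv] [mw iw].
(* For [b = c] the point [b] would lie in the closed first interval but not in []a, c[]. *)
case: (ltP b c) => [bc'|cb]; last first.
  have bE : b = c by lra.
  move: iw; rewrite bE set_itvoo0 integral_set0 => -[<-].
  by rewrite addr0; split; rewrite -bE.
have E : `]a, c[%classic = `]a, b] `|` `]b, c[ :> set R.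
  by apply: itv_bndbnd_setU; rewrite bnd_simp.
have mv' : measurable_fun (`]a, b] : set R) f.
  by apply/measurable_realfun.measurable_fun_itv_bndo_bndcP.
have iv' : (\int[lebesgue_measure]_(x in `]a, b]) (f x)%:E)%E = v%:E.
  rewrite -integral_itv_bndo_bndc //; exact/measurable_realfun.measurable_EFinP.
have mf : measurable_fun (`]a, b] `|` `]b, c[) f by apply/measurable_funU.
split; rewrite E //.
rewrite integral_setU //=; first by rewrite iv' iw.
- exact/measurable_realfun.measurable_EFinP.
- rewrite disj_set2E; apply/eqP/seteqP; split => x //= [].
  by rewrite !in_itv /= => /andP[_ xb] /andP[bx _]; lra.
Qed.

(** * The two steps as a conservative scheme *)

(* For nondecreasing [u], the integral of the reconstruction over the rightmost
   part of width [w] of cell [j]; the minimum is its first argument when the jump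
   lies outside this part, and its second one when the jump lies inside. *)
Definition outflow (R : realType) (w : R) (u : int -> R) (j : int) : R :=
  Num.min (w * u (j + 1)) (u j - (1 - w) * u (j - 1)).

(** The new cell consists of the rightmost [w] of cell [j - 1] and the leftmost [1 - w] of cell
    [j]. *)
Definition transport (R : realType) (w : R) (u : int -> R) (j : int) : R :=
  outflow w u (j - 1) + (u j - outflow w u j).

Lemma floor_cell (R : realType) (j : int) (s : R) :
  0 < s -> s < 1 -> Num.floor (j%:~R + 1 - s) = j.
Proof.
by move=> s0 s1; apply: floor_def; rewrite intrD; apply/andP; split; lra.
Qed.

Lemma rec_evenE (R : realType) (u : int -> R) (j : int) (s : R) :
  0 < s -> s < 1 ->
  rec_even u (j%:~R + 2^-1 - s) =
  if 0 < d_even u j < 1 then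
    if d_even u j < s then u (j - 1) else u (j + 1)
  else u j.
Proof.
move=> s0 s1; rewrite /rec_even.
have -> : j%:~R + 2^-1 - s + 2^-1 = j%:~R + 1 - s :> R by lra.
by rewrite floor_cell // opprB addrCA subrr addr0.
Qed.

(** [p] and [q] are distances from the right end of the cell, from which [d_even] is measured too.
    The translation [s] lets the result serve odd steps as well. *)
Lemma has_integral_cell (R : realType) (u : int -> R) (j : int) (s p q : R) :
  u (j - 1) <= u j -> u j <= u (j + 1) -> 0 <= p -> p <= q -> q <= 1 ->
  has_integral (fun x => rec_even u (x + s))
    (j%:~R + 2^-1 - q - s) (j%:~R + 2^-1 - p - s)
    (outflow q u j - outflow p u j).
Proof.
move=> ul ur p0 pq q1.
have recE k p' q' : 0 <= p' -> p' <= q' -> q' <= 1 ->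
    (forall t, p' < t -> t < q' -> rec_even u (j%:~R + 2^-1 - t) = k) ->
    has_integral (fun x => rec_even u (x + s))
      (j%:~R + 2^-1 - q' - s) (j%:~R + 2^-1 - p' - s) (k * (q' - p')).
  move=> p'0 pq' q'1 H.
  have -> : q' - p' = (j%:~R + 2^-1 - p' - s) - (j%:~R + 2^-1 - q' - s) by lra.
  apply: has_integral_const; first lra.
  move=> x; rewrite in_itv /= => /andP[x1 x2].
  rewrite -(H (j%:~R + 2^-1 - (x + s))); [|lra|lra].
  by congr rec_even; lra.
have recE' t : p < t -> t < q -> rec_even u (j%:~R + 2^-1 - t) =
    if 0 < d_even u j < 1 then
      if d_even u j < t then u (j - 1) else u (j + 1)
    else u j.
  move=> pt tq; apply: rec_evenE; first exact: le_lt_trans pt.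
  exact: lt_le_trans q1.
case: (boolP (0 < d_even u j < 1)) recE' => [/andP[d0 d1]|dN] recE'; last first.
  (* Without a jump, monotonicity forces [u j] to equal a neighbouring value, and then [outflow] is
     linear in [w]. *)
  have oE w : 0 <= w -> w <= 1 -> outflow w u j = w * u j.
    move=> w0 w1; move: dN; rewrite /d_even /outflow.
    case: eqP => [e _|/eqP e].
      have -> : u (j + 1) = u j by lra.
      have -> : u (j - 1) = u j by lra.
      by apply/min_idPl; lra.
    have D0 : 0 < u (j + 1) - u (j - 1) by rewrite lt_def e; lra.
    rewrite ltr_pdivrMr // mul1r pmulr_lgt0 ?invr_gt0 //.
    rewrite negb_and -!leNgt => /orP[le|ge].
      have -> : u j = u (j - 1) by lra.
      by rewrite mulrBl mul1r subKr; apply/min_idPr/ler_wpM2l => //; lra.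
    have -> : u (j + 1) = u j by lra.
    have w1' : 0 <= 1 - w by lra.
    by apply/min_idPl; have := ler_wpM2l w1' ul; lra.
  rewrite !oE; [|lra..].
  have -> : q * u j - p * u j = u j * (q - p) by ring.
  exact: recE.
(* A zero denominator would give the default value -1, against [0 < d_even u j]. *)
have D0 : u (j + 1) - u (j - 1) != 0.
  by apply: contraTN d0 => e; rewrite /d_even e -leNgt oppr_le0.
have Dp : 0 < u (j + 1) - u (j - 1) by rewrite lt_def D0; lra.
have dE : d_even u j * (u (j + 1) - u (j - 1)) = u j - u (j - 1).
  by rewrite /d_even (negbTE D0) divfK.
move: (d_even u j) dE d0 d1 recE' => d dE d0 d1 recE'.
(* The first argument of the minimum exceeds the second by [(w - d) * (u (j + 1) - u (j - 1))], so
   the minimum switches at the jump. *)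
have oL w : w <= d -> outflow w u j = w * u (j + 1).
  move=> wd; apply/min_idPl.
  have := ler_wpM2r (ltW Dp) wd; lra.
have oR w : d <= w -> outflow w u j = u j - (1 - w) * u (j - 1).
  move=> wd; apply/min_idPr.
  have := ler_wpM2r (ltW Dp) wd; lra.
(* The strip lies to the right of the jump, to its left, or contains it. *)
case: (leP q d) => [qd|dq].
  rewrite !oL //; last lra.
  rewrite -mulrBl mulrC; apply: recE => // t pt tq.
  by rewrite recE' // ltNge; case: leP => //; lra.
case: (leP d p) => [dp|pd].
  rewrite !oR //; last lra.
  have -> : u j - (1 - q) * u (j - 1) - (u j - (1 - p) * u (j - 1)) =
      u (j - 1) * (q - p) by ring.
  apply: recE => // t pt tq.
  by rewrite recE' // ifT //; lra.
rewrite oR ?oL; [|lra..].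
have -> : u j - (1 - q) * u (j - 1) - p * u (j + 1) =
    u (j - 1) * (q - d) + u (j + 1) * (d - p).
  by rewrite -[u j](subrK (u (j - 1))) -dE; ring.
apply: (@has_integral_cat _ _ _ (j%:~R + 2^-1 - d - s)); [lra|lra| |].
  apply: recE; [lra|lra|lra|] => t pt tq.
  by rewrite recE' ?pt //; lra.
apply: recE; [lra|lra|lra|] => t pt tq.
by rewrite recE' //; [case: ltP => //; lra|lra].
Qed.

Lemma integral_shifted_cell (R : realType) (w s : R) (u : int -> R) (j : int) :
  0 <= w -> w <= 1 -> {homo u : i k / i <= k} ->
  \int[lebesgue_measure]_(x in cell (j%:~R - w - s)) rec_even u (x + s) =
  transport w u j.
Proof.
move=> w0 w1 mu.
have uS k : u (k - 1) <= u k /\ u k <= u (k + 1) by split; apply: mu; lia.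
have [u1 u2] := uS (j - 1); have [u3 u4] := uS j.
have I1 := has_integral_cell s u1 u2 (lexx 0) w0 w1.
have I2 := has_integral_cell s u3 u4 w0 w1 (lexx 1).
have o0 : outflow 0 u (j - 1) = 0.
  by rewrite /outflow mul0r subr0 mul1r; apply/min_idPl; lra.
have o1 : outflow 1 u j = u j.
  by rewrite /outflow mul1r subrr mul0r subr0; apply/min_idPr.
move: I1 I2; rewrite o0 o1 subr0 => I1 I2.
have [_ IE] : has_integral (fun x => rec_even u (x + s))
    (j%:~R - w - s - 2^-1) (j%:~R - w - s + 2^-1) (transport w u j).
  apply: (@has_integral_cat _ _ _ (j%:~R - 2^-1 - s)); [lra|lra| |].
    by move: I1; rewrite intrB; congr has_integral; lra.
  by move: I2; congr has_integral; lra.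
by rewrite /Rintegral /cell IE.
Qed.

Lemma step_even_transport (R : realType) (lam : R) (u : int -> R) :
  0 <= lam -> lam <= 1 -> {homo u : i k / i <= k} ->
  step_even lam u =1 transport lam u.
Proof.
move=> l0 l1 mu j; rewrite /step_even -(integral_shifted_cell 0 j l0 l1 mu).
by rewrite subr0; apply: eq_Rintegral => x _; rewrite addr0.
Qed.

(** [d_odd] measures from the left end the jump that [d_even] measures from the right end, so the
    two ratios add up to 1. *)
Lemma rec_oddE (R : realType) (lam : R) (u : int -> R) (x : R) :
  rec_odd lam u x = rec_even u (x + lam).
Proof.
rewrite /rec_odd /rec_even; set j := Num.floor _.
(* Both ratios default to -1, which breaks this relation; hence one of them is assumed to lie in (0,
   1). *)
have dE : 0 < d_odd u j < 1 -> d_even u j = 1 - d_odd u j.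
  rewrite /d_odd /d_even; case: eqP => [_|/eqP D0 _].
    by rewrite oppr_gt0 ltr10.
  by field.
have dE' : 0 < d_even u j < 1 -> d_even u j = 1 - d_odd u j.
  rewrite /d_odd /d_even; case: eqP => [_|/eqP D0 _].
    by rewrite oppr_gt0 ltr10.
  by field.
case: (boolP (0 < d_odd u j < 1)) => [h1|oN];
  case: (boolP (0 < d_even u j < 1)) => [h2|eN] //.
- rewrite dE //.
  suff -> : (1 - d_odd u j < j%:~R + 2^-1 - (x + lam)) =
            (x - (j%:~R - lam - 2^-1) < d_odd u j) by [].
  by apply/idP/idP => h; lra.
- by move: eN; rewrite dE // => /negP[]; lra.
- by move: oN; rewrite -[d_odd u j](subKr 1) -dE' // => /negP[]; lra.
Qed.

(* Moving the grid right by [lam] is moving it left by [1 - lam] and renumbering. *)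
Lemma step_odd_transport (R : realType) (lam : R) (u : int -> R) (j : int) :
  0 <= lam -> lam <= 1 -> {homo u : i k / i <= k} ->
  step_odd lam u j = transport (1 - lam) u (j + 1).
Proof.
move=> l0 l1 mu; rewrite -(integral_shifted_cell lam) //; [|lra|lra].
rewrite /step_odd intrD.
have -> : j%:~R + 1 - (1 - lam) - lam = j%:~R :> R by lra.
by apply: eq_Rintegral => x _; rewrite rec_oddE.
Qed.

(** * Fronts with four intermediate values *)

Definition front (R : realType) (b1 b2 b3 b4 : R) (j : int) : R :=
  if j <= 0 then 0 else if j <= 1 then b1 else if j <= 2 then b2
  else if j <= 3 then b3 else if j <= 4 then b4 else 1.

Lemma initial_data_front (R : realType) (a : 'rV[R]_4) :
  initial_data a = front (a 0 0) (a 0 1) (a 0 2) (a 0 3).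
Proof.
apply/funext => j; rewrite /initial_data /front.
have [j0|j0] := leP j 0 => //.
have inordE k (i : 'I_4) : k = i :> nat -> inord k = i.
  by move=> ->; rewrite inord_val.
have [j1|j1] := leP j 1.
  by rewrite ifT; [congr (a 0 _); apply: inordE => /=|]; lia.
have [j2|j2] := leP j 2.
  by rewrite ifT; [congr (a 0 _); apply: inordE => /=|]; lia.
have [j3|j3] := leP j 3.
  by rewrite ifT; [congr (a 0 _); apply: inordE => /=|]; lia.
by have [j4|//] := leP j 4; congr (a 0 _); apply: inordE => /=; lia.
Qed.

Lemma front_shift (R : realType) (b2 b3 b4 : R) (j : int) :
  front 0 b2 b3 b4 (j + 1) = front b2 b3 b4 1 j.
Proof. by rewrite /front; do !case: ifP => //; lia. Qed.

Definition sorted01 (R : realType) (b1 b2 b3 b4 : R) : Prop :=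
  [/\ 0 <= b1, b1 <= b2, b2 <= b3, b3 <= b4 & b4 <= 1].

Lemma front_homo (R : realType) (b1 b2 b3 b4 : R) :
  sorted01 b1 b2 b3 b4 -> {homo front b1 b2 b3 b4 : i k / i <= k}.
Proof.
move=> [h0 h1 h2 h3 h4] i k ik; rewrite /front.
by do !(case: ifP => ?); first [exfalso; lia | clear ik; lra].
Qed.

Lemma front_itv (R : realType) (b1 b2 b3 b4 : R) (j : int) :
  sorted01 b1 b2 b3 b4 -> 0 <= front b1 b2 b3 b4 j <= 1.
Proof.
by move=> [h0 h1 h2 h3 h4]; rewrite /front; do !(case: ifP => _); lra.
Qed.

(** The last hypothesis makes cell 4 send out exactly [w], so cell 5 loses what it receives and
    stays at 1; cells up to 0 send out nothing. *)
Lemma transport_front (R : realType) (w b1 b2 b3 b4 : R) :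
  sorted01 b1 b2 b3 b4 -> 0 <= w -> w <= 1 -> w <= b4 - (1 - w) * b3 ->
  let o1 := Num.min (w * b2) b1 in
  let o2 := Num.min (w * b3) (b2 - (1 - w) * b1) in
  let o3 := Num.min (w * b4) (b3 - (1 - w) * b2) in
  transport w (front b1 b2 b3 b4) =1
    front (b1 - o1) (o1 + (b2 - o2)) (o2 + (b3 - o3)) (o3 + (b4 - w)).
Proof.
move=> sb w0 w1 w4 o1 o2 o3 j; set u := front b1 b2 b3 b4.
have u01 i : 0 <= u i <= 1 by exact: front_itv.
have uN i : i <= 0 -> u i = 0 by rewrite /u /front => ->.
have uP i : 5 <= i -> u i = 1.
  by rewrite /u /front => i5; do !case: ifP => //; lia.
have oN i : i <= 0 -> outflow w u i = 0.
  move=> i0; rewrite /outflow (uN i) // (uN (i - 1)) ?mulr0 ?subr0; last lia.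
  by apply/min_idPr/mulr_ge0 => //; have /andP[] := u01 (i + 1).
have oP i : 5 <= i -> outflow w u i = w.
  move=> i5; rewrite /outflow (uP i) // (uP (i + 1)) ?mulr1; last lia.
  apply/min_idPl; have /andP[_ v1] := u01 (i - 1).
  have w1' : 0 <= 1 - w by lra.
  by have := ler_wpM2l w1' v1; lra.
have O1 : outflow w u 1 = o1 by rewrite /outflow /u /front /= mulr0 subr0.
have O2 : outflow w u 2 = o2 by [].
have O3 : outflow w u 3 = o3 by [].
have O4 : outflow w u 4 = w.
  by rewrite /outflow /u /front /= mulr1; apply/min_idPl.
rewrite /transport.
have [j0|j0] := leP j 0.
  by rewrite (oN (j - 1)) ?(oN j) ?(uN j) //= ?subrr ?addr0 /front ?j0 //; lia.
have [j6|j6] := leP 6 j.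
  rewrite (oP (j - 1)) ?(oP j) ?(uP j); [|lia..].
  by rewrite /front; do !(case: ifP => ?); first [exfalso; lia | lra].
have [->|[->|[->|[->|->]]]] : j = 1 \/ j = 2 \/ j = 3 \/ j = 4 \/ j = 5 by lia.
- by rewrite O1 oN // add0r.
- by rewrite O2 O1.
- by rewrite O3 O2.
- by rewrite O4 O3.
- by rewrite (oP 5) // O4 uP // addrC subrK.
Qed.

Lemma step_even_front (R : realType) (lam b1 b2 b3 b4 : R) :
  sorted01 b1 b2 b3 b4 -> 0 <= lam -> lam <= 1 ->
  lam <= b4 - (1 - lam) * b3 ->
  let o1 := Num.min (lam * b2) b1 in
  let o2 := Num.min (lam * b3) (b2 - (1 - lam) * b1) in
  let o3 := Num.min (lam * b4) (b3 - (1 - lam) * b2) in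
  step_even lam (front b1 b2 b3 b4) =
    front (b1 - o1) (o1 + (b2 - o2)) (o2 + (b3 - o3)) (o3 + (b4 - lam)).
Proof.
move=> sb l0 l1 l4 o1 o2 o3; apply/funext => j.
by rewrite step_even_transport //; [exact: transport_front|exact: front_homo].
Qed.

(** A zero in the first slot stays there under [transport]; the renumbering then drops it and brings
    a 1 into the fourth slot. *)
Lemma step_odd_front (R : realType) (lam b2 b3 b4 : R) :
  sorted01 0 b2 b3 b4 -> 0 <= lam -> lam <= 1 ->
  1 - lam <= b4 - lam * b3 ->
  let o2 := Num.min ((1 - lam) * b3) b2 in
  let o3 := Num.min ((1 - lam) * b4) (b3 - lam * b2) in
  step_odd lam (front 0 b2 b3 b4) =
    front (b2 - o2) (o2 + (b3 - o3)) (o3 + (b4 - (1 - lam))) 1.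
Proof.
move=> sb l0 l1 l4 o2 o3; have [_ b20 _ _ _] := sb; apply/funext => j.
rewrite step_odd_transport //; last exact: front_homo.
rewrite transport_front ?subKr //; [|lra|lra].
rewrite (min_idPr _); last by rewrite mulr_ge0 // subr_ge0.
by rewrite subrr mulr0 subr0 add0r front_shift.
Qed.

(** * The 2-periodic front *)

Lemma step_even_block (R : realType) (lam c : R) :
  0 <= lam -> lam <= c -> c <= 1 ->
  step_even lam (front 0 0 c 1) = front 0 0 (c - lam) 1.
Proof.
move=> l0 lc c1; have l1 : lam <= 1 by lra.
have h1 : 0 <= lam * c by apply: mulr_ge0; lra.
have h2 : (1 - lam) * c <= (1 - lam) * 1 by apply: ler_wpM2l; lra.
rewrite step_even_front //; [|by split; lra|lra].
rewrite !mulr0 !mulr1 !subr0 minxx (min_idPr h1) (min_idPl lc).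
by congr front; lra.
Qed.

(** Cell 3 empties into cell 4, which keeps [lam] of its own value 1; the renumbering brings the sum
    back to index 3. *)
Lemma step_odd_block (R : realType) (lam c : R) :
  0 <= lam -> 0 <= c -> c <= 1 - lam ->
  step_odd lam (front 0 0 c 1) = front 0 0 (c + lam) 1.
Proof.
move=> l0 c0 cl; have l1 : lam <= 1 by lra.
have h1 : 0 <= (1 - lam) * c by apply: mulr_ge0; lra.
have h2 : lam * c <= lam * 1 by apply: ler_wpM2l; lra.
rewrite step_odd_front //; [|by split; lra|lra].
rewrite !mulr0 !mulr1 !subr0 (min_idPr h1) (min_idPr cl).
by congr front; lra.
Qed.

(** * Three steps from the chosen initial data to the 2-periodic front *)

(** Since [a1 < lam * a2], the value [a1] leaves cell 1 entirely; cell 3, with [a3] near (1 +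
    lam)/2, sends out [lam * a4] and is left with about (1 - lam)/2. *)
Lemma step_even_small_tail (R : realType) (lam t a1 a2 a3 a4 : R) :
  0 < lam -> lam < 1 -> 0 < t -> 100 * t <= lam ->
  100 * t <= (1 - lam) * (1 - lam) ->
  0 < a1 -> a1 < lam * t -> t < a2 -> a2 < 3 * t ->
  (1 + lam) / 2 - t < a3 -> a3 < (1 + lam) / 2 + t -> 1 - t < a4 -> a4 < 1 ->
  exists v2 v3 v4,
    [/\ 0 <= v2 <= 2 * t, (1 - lam) / 2 - t <= v3 <= (1 - lam) / 2 + 5 * t,
      1 - 2 * t <= v4 <= 1 &
      step_even lam (front a1 a2 a3 a4) = front 0 v2 v3 v4].
Proof.
move=> l0 l1 t0 tl tm2 a1_gt a1_lt a2_gt a2_lt a3_gt a3_lt a4_gt a4_lt.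
have m0 : 0 < 1 - lam by lra.
have mm : (1 - lam) * (1 - lam) <= 1 - lam by rewrite ler_piMl; lra.
have mt : (1 - lam) * t <= t by rewrite ler_piMl; lra.
have lt_le : lam * t <= t by rewrite ler_piMl; lra.
have ma1 : 0 <= (1 - lam) * a1 <= a1.
  by apply/andP; split; [rewrite mulr_ge0; lra|rewrite ler_piMl; lra].
have la1 : lam * a1 <= a1 by rewrite ler_piMl; lra.
have ma2 : (1 - lam) * a2 <= a2 by rewrite ler_piMl; lra.
have la2 : lam * t <= lam * a2 by rewrite ler_pM2l; lra.
have la3 : lam * 4^-1 <= lam * a3 by rewrite ler_pM2l; lra.
have la4 : lam * (1 - t) <= lam * a4 <= lam * 1.
  by rewrite !ler_pM2l //; lra.
have ma3 : (1 - lam) * a3 <= (1 - lam) * ((1 + lam) / 2 + t).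
  by rewrite ler_pM2l; lra.
(* The outflow condition at cell 4 holds with a margin of about [(1 - lam) ^ 2 / 2]: hence the
   quadratic bound on [t]. *)
rewrite step_even_front; [|by split; lra|lra|lra|lra].
rewrite (min_idPr _); last lra.
rewrite (min_idPr _); last lra.
rewrite (min_idPl _); last lra.
rewrite subrr; do 3!eexists; split; [| | |reflexivity]; lra.
Qed.

(** Conservation gives [w2 + w3 = v2 + v3 + v4 - (1 - lam)], about (1 + lam)/2 and so below 1; this
    sum is the value of the coming single-valued front. *)
Lemma step_odd_small_tail (R : realType) (lam t v2 v3 v4 : R) :
  0 < lam -> lam < 1 -> 0 < t -> 100 * t <= lam ->
  100 * t <= (1 - lam) * (1 - lam) ->
  0 <= v2 <= 2 * t -> (1 - lam) / 2 - t <= v3 <= (1 - lam) / 2 + 5 * t ->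
  1 - 2 * t <= v4 <= 1 ->
  exists w2 w3,
    [/\ 0 <= w2 <= 4 * t, (1 + lam) / 2 - 5 * t <= w3, w2 + w3 <= 1 &
      step_odd lam (front 0 v2 v3 v4) = front 0 w2 w3 1].
Proof.
move=> l0 l1 t0 tl tm2 /andP[v2_ge v2_le] /andP[v3_ge v3_le] /andP[v4_ge v4_le].
have m0 : 0 < 1 - lam by lra.
have mm : (1 - lam) * (1 - lam) <= 1 - lam by rewrite ler_piMl; lra.
have lv2 : 0 <= lam * v2 <= v2.
  by apply/andP; split; [rewrite mulr_ge0; lra|rewrite ler_piMl; lra].
have mv3 : (1 - lam) * ((1 - lam) / 2 - t) <= (1 - lam) * v3.
  by rewrite ler_pM2l.
have mt : (1 - lam) * t <= t by rewrite ler_piMl; lra.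
have mv4 : (1 - lam) * (1 - 2 * t) <= (1 - lam) * v4 by rewrite ler_pM2l.
have lv3 : lam * v3 <= lam * 2^-1 by rewrite ler_pM2l; lra.
rewrite step_odd_front; [|by split; lra|lra|lra|lra].
rewrite (min_idPr _); last lra.
rewrite (min_idPr _); last lra.
rewrite subrr; do 2!eexists; split; [| | |reflexivity]; lra.
Qed.

(** Cell 2 empties into cell 3, which passes on the full [lam]: two intermediate values merge into
    one. *)
Lemma step_even_absorb (R : realType) (lam t w2 w3 : R) :
  0 < lam -> lam < 1 -> 0 < t -> 100 * t <= lam ->
  100 * t <= (1 - lam) * (1 - lam) ->
  0 <= w2 <= 4 * t -> (1 + lam) / 2 - 5 * t <= w3 -> w2 + w3 <= 1 ->
  step_even lam (front 0 w2 w3 1) = front 0 0 (w2 + w3 - lam) 1.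
Proof.
move=> l0 l1 t0 tl tm2 /andP[w2_ge w2_le] w3_ge w23.
have mm : (1 - lam) * (1 - lam) <= 1 - lam by rewrite ler_piMl; lra.
have lw3 : lam * 4^-1 <= lam * w3 by rewrite ler_pM2l; lra.
have mw2 : (1 - lam) * w2 <= w2 by rewrite ler_piMl; lra.
have mw3 : (1 - lam) * w3 <= (1 - lam) * 1 by rewrite ler_pM2l; lra.
rewrite step_even_front; [|by split; lra|lra|lra|lra].
rewrite (min_idPr _); last by rewrite mulr_ge0; lra.
rewrite (min_idPr _); last lra.
rewrite (min_idPl _); last lra.
by congr front; lra.
Qed.

(** * The ball of initial data and the rate of convergence *)

Lemma alt_process_even (R : realType) (lam : R) (u0 : int -> R) (n : nat) :
  alt_process lam u0 (2 * n.+1) =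
  step_odd lam (step_even lam (alt_process lam u0 (2 * n))).
Proof. by rewrite mulnS /= mul2n odd_double. Qed.

Theorem theorem3 (R : realType) (lam : R)
    (hlam0 : 0 < lam) (hlam1 : lam < 1) (hlam2 : lam != 2^-1) :
  exists U : set 'rV[R]_4,
    [/\ open U, U !=set0, U `<=` @increasing_quadruples R &
      forall a : 'rV[R]_4, U a ->
        exists (uinf : int -> R) (C rho : R),
          [/\ 0 < C, 0 < rho, rho < 1 &
            forall n : nat,
              (ereal_sup
                 [set `|alt_process lam (initial_data a) (2 * n)%N j
                          - uinf j|%:E | j in [set: int]]
               <= (C * rho ^+ n)%:E)%E]].
Proof.
have m0 : 0 < 1 - lam by lra.
(* Both factors are at most 1, so [100 * t] is at most [lam] and at most [(1 - lam) ^ 2]. *)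
pose t := lam * ((1 - lam) * (1 - lam)) / 100.
have t0 : 0 < t by rewrite divr_gt0 ?mulr_gt0.
have mm : (1 - lam) * (1 - lam) <= 1 - lam by rewrite ler_piMl; lra.
have tm2 : 100 * t <= (1 - lam) * (1 - lam).
  by rewrite /t mulrC divfK // ler_piMl ?mulr_ge0; lra.
have tl : 100 * t <= lam by rewrite /t mulrC divfK // ler_piMr; lra.
(* The first and last coordinates of the centre lie at distance [r] from 0 and 1, and
   [2 * r = lam * t] is the bound wanted for the first one. *)
pose r := lam * t / 2.
have lt0 : 0 < lam * t by rewrite mulr_gt0.
have r0 : 0 < r by rewrite /r; lra.
have rE : 2 * r = lam * t by rewrite /r mulrC divfK.
have lt_t : lam * t <= t by rewrite ler_piMl; lra.
pose x0 : 'rV[R]_4 :=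
  \row_(i < 4) [:: r; 2 * t; (1 + lam) / 2; 1 - r]`_i.
have near_x0 a : ball x0 r a ->
    [/\ 0 < a 0 0 /\ a 0 0 < lam * t, t < a 0 1 /\ a 0 1 < 3 * t,
      (1 + lam) / 2 - t < a 0 2 /\ a 0 2 < (1 + lam) / 2 + t &
      1 - t < a 0 3 /\ a 0 3 < 1].
  move=> [_ xa].
  have H k : `|x0 0 k - a 0 k| < r := xa 0 k.
  have := H 0; have := H 1; have := H 2; have := H 3.
  rewrite !mxE /= !ltr_norml => /andP[? ?] /andP[? ?] /andP[? ?] /andP[? ?].
  split; split; lra.
exists (ball x0 r); split.
- exact: ball_open.
- by exists x0; exact: ballxx.
- by move=> a /near_x0[[? ?] [? ?] [? ?] [? ?]]; split; lra.
move=> a /near_x0[[? ?] [? ?] [? ?] [? ?]].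
have sa : sorted01 (a 0 0) (a 0 1) (a 0 2) (a 0 3) by split; lra.
have [v2 [v3 [v4 [v2P v3P v4P ev]]]] : exists v2 v3 v4,
    [/\ 0 <= v2 <= 2 * t, (1 - lam) / 2 - t <= v3 <= (1 - lam) / 2 + 5 * t,
      1 - 2 * t <= v4 <= 1 &
      step_even lam (initial_data a) = front 0 v2 v3 v4].
  by rewrite initial_data_front; exact: step_even_small_tail.
have [w2 [w3 [w2P w3P w23 ow]]] :=
  step_odd_small_tail hlam0 hlam1 t0 tl tm2 v2P v3P v4P.
have [c cE] : exists c, c = w2 + w3 by exists (w2 + w3).
have /andP[w2_ge w2_le] := w2P.
have [w3_ge w3_le] : 0 <= w3 /\ w3 <= 1 by split; lra.
have c_ge : lam <= c by lra.
have c_le : c <= 1 by rewrite cE.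
have c_ge0 : 0 <= c by apply: le_trans c_ge; exact: ltW.
have step_c : step_odd lam (front 0 0 (c - lam) 1) = front 0 0 c 1.
  by rewrite step_odd_block ?subrK ?subr_ge0 ?lerB // ltW.
(* Even times are stationary from time 4 on: three steps reach the single-valued front with
   [c - lam], and the fourth restores [c]. *)
have aE n : alt_process lam (initial_data a) (2 * n.+2)%N =
    front 0 0 (c) 1.
  elim: n => [|n IH].
    rewrite !alt_process_even muln0 /= ev ow.
    by rewrite (step_even_absorb hlam0 hlam1 t0 tl tm2 w2P w3P w23) -cE step_c.
  by rewrite alt_process_even IH step_even_block // ltW.
have sc : sorted01 0 0 (c) 1 by split; lra.
(* Only times 0 and 2 can carry an error, at most 1 as all values lie in [0, 1]; at [n = 1] the
   bound [C * rho] is 1. *)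
exists (front 0 0 (c) 1), 2, 2^-1; split => [||| n]; first by [].
- by rewrite invr_gt0.
- by rewrite invf_lt1 ?ltr1n.
apply: ge_ereal_sup => _ [j _ <-]; rewrite lee_fin.
have /andP[f0 f1] := front_itv j sc.
case: n => [|[|n]]; last first.
- by rewrite aE subrr normr0 mulr_ge0 // exprn_ge0.
- have sw : sorted01 0 w2 w3 1 by split => //; lra.
  rewrite alt_process_even muln0 /= ev ow ler_norml.
  by have /andP[] := front_itv j sw; lra.
- rewrite muln0 /= initial_data_front ler_norml.
  by have /andP[] := front_itv j sa; lra.
Qed.
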